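(* The quantitative emptiness problem for PosDisc and the quantitative universality problem for AsDisc are decidable. That is, there is an algorithm that, given a probabilistic weighted automaton $A$ over $\Sigma$ with rational data, a discount factor $\lambda\in(0,1)\cap\mathbb Q$ and a rational $\nu$, decides whether there is $w\in\Sigma^\omega$ with $L^{>0}_A(w)\ge\nu$; and one that decides whether $L^{=1}_A(w)\ge\nu$ for all $w\in\Sigma^\omega$; here the value function is $\mathsf{Disc}_\lambda$.
   Context: A probabilistic weighted automaton over a finite alphabet $\Sigma$ is a tuple $A=(Q,\rho_I,\Sigma,\delta,\gamma)$ where $Q$ is a finite set of states, $\rho_I$ is a probability distribution on $Q$, $\delta:Q\times\Sigma\to\mathcal D(Q)$ assigns to each state and letter a probability distribution on $Q$, and $\gamma:Q\times\Sigma\times Q\to\mathbb Q$ is a weight function. A run over an infinite word $w=\sigma_1\sigma_2\dots$ is a sequence $r=q_0\sigma_1q_1\sigma_2\dots$ with $\rho_I(q_0)>0$ and $\delta(q_i,\sigma_{i+1})(q_{i+1})>0$ for all $i$; its weight sequence is $\gamma(r)=v_0v_1\dots$ with $v_i=\gamma(q_i,\sigma_{i+1},q_{i+1})$. For each $w$, the probabilities of finite run prefixes $\rho_I(q_0)\prod_{i=1}^k\delta(q_{i-1},\sigma_i)(q_i)$ induce a probability measure $\mathbb P^A$ on runs over $w$. With $\mathsf{Disc}_\lambda(v)=\sum_{i\ge0}\lambda^iv_i$, the positive semantics is $L^{>0}_A(w)=\sup\{\eta\mid \mathbb P^A(\{r:\mathsf{Disc}_\lambda(\gamma(r))\ge\eta\})>0\}$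 and the almost-sure semantics is $L^{=1}_A(w)=\sup\{\eta\mid \mathbb P^A(\{r:\mathsf{Disc}_\lambda(\gamma(r))\ge\eta\})=1\}$. PosDisc and AsDisc denote the classes of $\mathsf{Disc}$-automata under positive and almost-sure semantics. *)

(* Defs.v *)
From HB Require Import structures.
From mathcomp Require Import all_boot all_order all_algebra.
From mathcomp Require Import classical_sets reals ereal topology normedtype sequences.
From mathcomp Require Import Rstruct Rstruct_topology.
From Stdlib Require PeanoNat.
Set Implicit Arguments. Unset Strict Implicit. Unset Printing Implicit Defensive.
Import Order.TTheory GRing.Theory Num.Theory.

Inductive code : Type :=
| cZero : code
| cSucc : code
| cProj : nat -> code
| cComp : code -> list code -> code
| cPrec : code -> code -> code
| cMin  : code -> code.

Inductive eval : code -> list nat -> nat -> Prop :=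
| eZero v : eval cZero v 0
| eSucc x v : eval cSucc (x :: v) x.+1
| eProj i v : eval (cProj i) v (nth 0 v i)
| eComp f gs v ys y : evals gs v ys -> eval f ys y -> eval (cComp f gs) v y
| ePrec0 f g v y : eval f v y -> eval (cPrec f g) (0 :: v) y
| ePrecS f g n v r y : eval (cPrec f g) (n :: v) r -> eval g (n :: r :: v) y ->
    eval (cPrec f g) (n.+1 :: v) y
| eMin f v n : eval f (n :: v) 0 ->
    (forall m, m < n -> exists k, eval f (m :: v) k.+1) -> eval (cMin f) v n
with evals : list code -> list nat -> list nat -> Prop :=
| esNil v : evals nil v nil
| esCons g gs v y ys : eval g v y -> evals gs v ys -> evals (g :: gs) v (y :: ys).

Definition decidable_nat (P : nat -> Prop) : Prop :=
  exists c : code, forall n : nat,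
    (P n -> eval c [:: n] 1) /\ (~ P n -> eval c [:: n] 0).

(* states are 0..nst-1, letters 0..nal-1 *)
Record pwa_instance := PWA {
  nst : nat;
  nal : nat;
  init : nat -> rat;
  delta : nat -> nat -> nat -> rat;
  gamma : nat -> nat -> nat -> rat;
  lam : rat;
  nu : rat
}.

(* Cantor unpairing *)
Definition unpair (n : nat) : nat * nat :=
  let w := (Nat.sqrt (8 * n + 1)).-1 %/ 2 in
  let t := (w * w.+1) %/ 2 in
  let y := n - t in (w - y, y).

Fixpoint decode_list_aux (k m : nat) : seq nat :=
  match k with
  | 0 => [::]
  | k'.+1 => let p := unpair m in p.1 :: decode_list_aux k' p.2
  end.

Definition decode_list (n : nat) : seq nat :=
  let p := unpair n in decode_list_aux p.1 p.2.

Definition decode_int (a : nat) : int :=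
  if odd a then (- Posz ((a.+1)./2))%R else Posz (a./2).

Definition decode_rat (x : nat) : rat :=
  let p := unpair x in ((decode_int p.1)%:~R / (p.2.+1)%:R)%R.

Definition decode (n : nat) : pwa_instance :=
  let l := decode_list n in
  let ns := nth 0 l 0 in
  let na := nth 0 l 1 in
  let q k := decode_rat (nth 0 l k) in
  PWA ns na
    (fun s => q (4 + s))
    (fun s a s' => q (4 + ns + (s * na + a) * ns + s'))
    (fun s a s' => q (4 + ns + ns * na * ns + (s * na + a) * ns + s'))
    (q 2) (q 3).

Definition wf (I : pwa_instance) : Prop :=
  [/\ (forall q, (q < nst I)%N -> 0 <= init I q)%R,
      (\sum_(q < nst I) init I q = 1)%R,
      (forall q a q', (q < nst I)%N -> (a < nal I)%N -> (q' < nst I)%N -> 0 <= delta I q a q')%R,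
      (forall q a, (q < nst I)%N -> (a < nal I)%N -> \sum_(q' < nst I) delta I q a q' = 1)%R
    & (0 < lam I < 1)%R].

Local Open Scope ring_scope.
Local Open Scope classical_set_scope.

Notation RR := Rdefinitions.R.

Definition Disc (l : RR) (v : nat -> RR) : RR :=
  limn (series (fun i => l ^+ i * v i)).

(* words: w : nat -> nat, letter sigma_{i+1} is w i; runs: r : nat -> nat,
   state q_i is r i *)
Definition is_run (I : pwa_instance) (w : nat -> nat) (r : nat -> nat) : Prop :=
  (forall i, (r i < nst I)%N) /\ 0 < init I (r 0) /\
  (forall i, 0 < delta I (r i) (w i) (r i.+1)).

Definition weight_seq (I : pwa_instance) (w r : nat -> nat) : nat -> RR :=
  fun i => ratr (gamma I (r i) (w i) (r i.+1)).

Fixpoint prefix_prob_aux (I : pwa_instance) (w : nat -> nat) (i : nat)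
    (q : nat) (u : seq nat) : RR :=
  match u with
  | [::] => 1
  | q' :: u' =>
      (if (q' < nst I)%N then ratr (delta I q (w i) q') else 0) *
      prefix_prob_aux I w i.+1 q' u'
  end.

Definition prefix_prob (I : pwa_instance) (w : nat -> nat) (u : seq nat) : RR :=
  match u with
  | [::] => 1
  | q0 :: u' => (if (q0 < nst I)%N then ratr (init I q0) else 0) *
                prefix_prob_aux I w 0 q0 u'
  end.

Definition cyl (u : seq nat) : set (nat -> nat) :=
  [set r | forall i, (i < size u)%N -> r i = nth 0 u i].

(* P^A over w of a set E of state sequences: the Caratheodory (outer)
   measure generated by the cylinder probabilities; on measurable sets
   (such as the events below) this is the induced probability measure. *)
Definition prob (I : pwa_instance) (w : nat -> nat) (E : set (nat -> nat)) : \bar RR :=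
  ereal_inf [set x | exists f : nat -> seq nat,
     E `<=` \bigcup_i cyl (f i) /\
     x = (\sum_(i <oo) (prefix_prob I w (f i))%:E)%E].

Definition event (I : pwa_instance) (w : nat -> nat) (eta : RR) : set (nat -> nat) :=
  [set r | is_run I w r /\ eta <= Disc (ratr (lam I)) (weight_seq I w r)].

Definition L_pos (I : pwa_instance) (w : nat -> nat) : \bar RR :=
  ereal_sup [set eta%:E | eta in [set eta : RR | (0 < prob I w (event I w eta))%E]].

Definition L_as (I : pwa_instance) (w : nat -> nat) : \bar RR :=
  ereal_sup [set eta%:E | eta in [set eta : RR | prob I w (event I w eta) = 1%E]].

Definition is_word (I : pwa_instance) (w : nat -> nat) : Prop :=
  forall i, (w i < nal I)%N.

Definition PosDisc_nonempty (I : pwa_instance) : Prop :=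
  wf I /\ exists w, is_word I w /\ ((ratr (nu I))%:E <= L_pos I w)%E.

Definition AsDisc_universal (I : pwa_instance) : Prop :=
  wf I /\ forall w, is_word I w -> ((ratr (nu I))%:E <= L_as I w)%E.

(* Main.v *)
(* Runs sharing a prefix of positive probability have close discounted sums, so the
   positive value of a word is the supremum, and its almost-sure value the infimum, of
   the discounted sums of its runs.  Both problems thus ask for an optimal path in the
   weighted transition graph, from which the word can be read off.  The optimal values
   solve the Bellman equation V q = max (gamma q a q' + lambda V q') over the edges,
   whose unique solution is rational, being the value of one of finitely many positional
   policies.  The algorithm enumerates rational vectors until it meets this solution,
   and compares its initial entries with nu; minimisation is maximisation for - gamma. *)
From HB Require Import structures.
From mathcomp Require Import all_boot all_order all_algebra.
From mathcomp Require Import ring lra zify.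
From mathcomp Require Import boolp classical_sets reals ereal topology normedtype sequences.
From mathcomp Require Import Rstruct Rstruct_topology.
From Stdlib Require PeanoNat.
Require Import Defs.
Set Implicit Arguments. Unset Strict Implicit. Unset Printing Implicit Defensive.
Import Order.TTheory GRing.Theory Num.Theory numFieldNormedType.Exports.

(** Decidability means a code of the calculus [eval], so the search itself must be shown computable:
    everything it evaluates is reduced to arithmetic on natural numbers. It can meet a solution
    because policy evaluation is a linear system over [rat], invertible thanks to the discount;
    [PosDisc_bellman] and [AsDisc_bellman] hold for whichever solution it meets. On the
    probabilistic side [prob] is an outer measure, handled through two inequalities: a set
    containing all runs of a cylinder has at least the mass of that cylinder ([prob_ge]), and a
    finite cover bounds a set from above ([prob_le_sum]). The first is the delicate one, since it
    must defeat every countable cover. An optimal run may itself have probability 0, so optimal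
    values are approached through cylinders around it, at the price of an arbitrarily small error.
    Ill-formed instances and empty alphabets are answered without a Bellman solution. *)

(** * Total computable functions *)

(* Argument lists of length [k], so that contexts can be projected and extended
   by conversion. *)
Fixpoint ctx (k : nat) : Type := if k is k'.+1 then (nat * ctx k')%type else unit.

Fixpoint ctx_seq (k : nat) : ctx k -> seq nat :=
  if k is k'.+1 then fun t => t.1 :: ctx_seq t.2 else fun=> [::].

Definition comp k (f : ctx k -> nat) : Prop :=
  exists c, forall t, eval c (ctx_seq t) (f t).

Definition compb k (f : ctx k -> bool) : Prop := comp (fun t => nat_of_bool (f t)).

Lemma eq_comp k (f g : ctx k -> nat) : f =1 g -> comp f -> comp g.
Proof. by move=> fg [c cf]; exists c => t; rewrite -fg. Qed.

Lemma eq_compb k (f g : ctx k -> bool) : f =1 g -> compb f -> compb g.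
Proof. by move=> fg; apply: eq_comp => t; rewrite fg. Qed.

Lemma comp_nth k i : comp (fun t : ctx k => nth 0 (ctx_seq t) i).
Proof. by exists (cProj i) => t; constructor. Qed.

Lemma size_ctx_seq k (t : ctx k) : size (ctx_seq t) = k.
Proof. by elim: k t => //= k IH t; rewrite IH. Qed.

Lemma evals_codes gs v ys :
  size gs = size ys -> (forall i, i < size gs -> eval (nth cZero gs i) v (nth 0 ys i)) ->
  evals gs v ys.
Proof.
elim: gs ys => [|g gs IH] [|y ys] //= E H; constructor.
- exact: (H 0).
- by apply: IH => [|i Hi]; [case: E|apply: (H i.+1)].
Qed.

(** Computable substitutions between contexts. With [comp_subst] they reduce weakening and
    reordering of arguments to [cComp] and projections. *)
Definition comps k l (s : ctx k -> ctx l) : Prop :=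
  exists gs, forall t, evals gs (ctx_seq t) (ctx_seq (s t)).

Lemma comps_nil k : comps (fun _ : ctx k => tt : ctx 0).
Proof. by exists [::] => t; constructor. Qed.

Lemma comps_cons k l f (s : ctx k -> ctx l) :
  comp f -> comps s -> comps (fun t => (f t, s t) : ctx l.+1).
Proof. by move=> [c cf] [gs gsP]; exists (c :: gs) => t; constructor. Qed.

Lemma comps_id k : comps (fun t : ctx k => t).
Proof.
exists (mkseq cProj k) => t; apply: evals_codes; rewrite size_mkseq ?size_ctx_seq // => i ik.
by rewrite nth_mkseq //; constructor.
Qed.

Lemma comp_subst k l (f : ctx l -> nat) (s : ctx k -> ctx l) :
  comp f -> comps s -> comp (fun t => f (s t)).
Proof.
move=> [c cf] [gs gsP]; exists (cComp c gs) => t.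
by apply: (eComp (gsP t)); apply: cf.
Qed.

Lemma comp_var0 k : comp (fun t : ctx k.+1 => t.1).
Proof. by apply: eq_comp (comp_nth k.+1 0). Qed.

Lemma comps_snd k : comps (fun t : ctx k.+1 => t.2).
Proof.
exists (mkseq (fun i => cProj i.+1) k) => t; apply: evals_codes.
  by rewrite size_mkseq size_ctx_seq.
move=> i; rewrite size_mkseq => ik.
by rewrite nth_mkseq //; apply: (eProj i.+1 (ctx_seq (t : ctx k.+1))).
Qed.

Lemma comps_snd2 k : comps (fun t : ctx k.+2 => t.2.2).
Proof.
exists (mkseq (fun i => cProj i.+2) k) => t; apply: evals_codes.
  by rewrite size_mkseq size_ctx_seq.
move=> i; rewrite size_mkseq => ik.
by rewrite nth_mkseq //; apply: (eProj i.+2 (ctx_seq (t : ctx k.+2))).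
Qed.

Lemma comp_wk k (f : ctx k -> nat) : comp f -> comp (fun t : ctx k.+1 => f t.2).
Proof. by move=> cf; apply: (comp_subst cf); apply: comps_snd. Qed.

Lemma comp_app1 k (h : nat -> nat) f :
  comp (fun t : ctx 1 => h t.1) -> comp f -> comp (fun t : ctx k => h (f t)).
Proof.
move=> ch cf; apply: (comp_subst (s := fun t => (f t, tt) : ctx 1) ch).
exact: (comps_cons cf (comps_nil _)).
Qed.

Lemma comp_app2 k (h : nat -> nat -> nat) f g :
  comp (fun t : ctx 2 => h t.1 t.2.1) -> comp f -> comp g ->
  comp (fun t : ctx k => h (f t) (g t)).
Proof.
move=> ch cf cg; apply: (comp_subst (s := fun t => (f t, (g t, tt)) : ctx 2) ch).
exact: (comps_cons cf (comps_cons cg (comps_nil _))).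
Qed.

Lemma comp_succ k f : comp f -> comp (fun t : ctx k => (f t).+1).
Proof. by apply: comp_app1; exists cSucc => t; constructor. Qed.

Lemma comp_const k n : comp (fun _ : ctx k => n).
Proof.
elim: n => [|n IH]; last exact: comp_succ.
by exists cZero => t; constructor.
Qed.

(** The step receives the counter before the accumulator, the order in which [cPrec] supplies
    them. *)
Fixpoint natrec (b : nat) (h : nat -> nat -> nat) (n : nat) : nat :=
  if n is n'.+1 then h n' (natrec b h n') else b.

Lemma comp_natrec k (b : ctx k -> nat) (h : ctx k -> nat -> nat -> nat) N :
  comp b -> comp (fun t : ctx k.+2 => h t.2.2 t.1 t.2.1) -> comp N ->
  comp (fun t => natrec (b t) (h t) (N t)).
Proof.
move=> [cb bP] [ch hP] cN.
have cr : comp (fun t : ctx k.+1 => natrec (b t.2) (h t.2) t.1).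
  exists (cPrec cb ch) => -[n t] /=.
  elim: n => [|n IH] /=; first by constructor; apply: bP.
  apply: (ePrecS IH); exact: (hP (n, (natrec (b t) (h t) n, t))).
apply: (comp_subst (s := fun t => (N t, t) : ctx k.+1) cr).
exact: (comps_cons cN (comps_id _)).
Qed.

(** To compute [f] it suffices to characterise [f t] as the least number passing a computable test;
    division, square root and the final search are obtained so. *)
Lemma comp_mu k (R : ctx k -> nat -> bool) (f : ctx k -> nat) :
  compb (fun t : ctx k.+1 => R t.2 t.1) ->
  (forall t, R t (f t)) -> (forall t m, m < f t -> ~~ R t m) -> comp f.
Proof.
move=> cR Rf Rm.
(* [cMin] looks for a zero preceded by positive values, so the test is negated: 0 where [R] holds, 1
   elsewhere. *)
have [c cP] : comp (fun t : ctx k.+1 => natrec 1 (fun _ _ => 0) (R t.2 t.1)).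
  by apply: (comp_natrec (h := fun _ _ _ => 0)) cR; apply: comp_const.
exists (cMin c) => t; constructor.
  by have := cP (f t, t); rewrite /= Rf.
by move=> m /Rm /negbTE mR; exists 0; have := cP (m, t); rewrite /= mR.
Qed.

Lemma comp_add k f g : comp f -> comp g -> comp (fun t : ctx k => f t + g t).
Proof.
apply: comp_app2; apply: (eq_comp (f := fun t : ctx 2 => natrec t.2.1 (fun _ r => r.+1) t.1)).
  by move=> [n [m []]] /=; elim: n => //= n ->.
apply: (comp_natrec (h := fun _ _ r => r.+1)); last exact: comp_var0.
  exact: comp_wk (comp_var0 _).
exact: comp_succ (comp_wk (comp_var0 _)).
Qed.

Lemma comp_bsum k (N : ctx k -> nat) (F : ctx k -> nat -> nat) :
  comp N -> comp (fun t : ctx k.+1 => F t.2 t.1) -> comp (fun t => \sum_(0 <= i < N t) F t i).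
Proof.
move=> cN cF; apply: (eq_comp (f := fun t => natrec 0 (fun i r => r + F t i) (N t))).
  move=> t; elim: (N t) => [|n /= ->]; first by rewrite big_geq.
  by rewrite big_nat_recr.
apply: (comp_natrec (h := fun t i r => r + F t i)) => //; first exact: comp_const.
apply: comp_add; first exact: comp_wk (comp_var0 _).
apply: (comp_subst (s := fun t : ctx k.+2 => (t.1, t.2.2) : ctx k.+1) cF).
exact: comps_cons (comp_var0 _) (comps_snd2 _).
Qed.

Lemma comp_mul k f g : comp f -> comp g -> comp (fun t : ctx k => f t * g t).
Proof.
apply: comp_app2; apply: (eq_comp (f := fun t : ctx 2 => \sum_(0 <= i < t.1) t.2.1)).
  by move=> t; rewrite sum_nat_const_nat subn0.
apply: (comp_bsum (F := fun (t : ctx 2) _ => t.2.1)); first exact: comp_var0.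
exact: comp_wk (comp_wk (comp_var0 _)).
Qed.

Lemma comp_pred k f : comp f -> comp (fun t : ctx k => (f t).-1).
Proof.
apply: comp_app1; apply: (eq_comp (f := fun t : ctx 1 => natrec 0 (fun i _ => i) t.1)).
  by move=> [[|n] []].
apply: (comp_natrec (h := fun _ i _ => i)); [exact: comp_const|exact: comp_var0..].
Qed.

Lemma comp_sub k f g : comp f -> comp g -> comp (fun t : ctx k => f t - g t).
Proof.
apply: comp_app2; apply: (eq_comp (f := fun t : ctx 2 => natrec t.1 (fun _ r => r.-1) t.2.1)).
  by move=> [m [n []]] /=; elim: n => [|n /= ->]; rewrite ?subn0 ?subnS.
apply: (comp_natrec (h := fun _ _ r => r.-1)); first exact: comp_var0.
  exact: comp_pred (comp_wk (comp_var0 _)).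
exact: comp_wk (comp_var0 _).
Qed.

Lemma comp_if k (b : ctx k -> bool) f g :
  compb b -> comp f -> comp g -> comp (fun t => if b t then f t else g t).
Proof.
move=> cb cf cg; apply: (eq_comp (f := fun t => b t * f t + (1 - b t) * g t)).
  by move=> t; case: (b t); rewrite ?mul1n ?mul0n ?addn0.
apply: comp_add; apply: comp_mul => //; apply: comp_sub => //; exact: comp_const.
Qed.

Lemma compb_not k (b : ctx k -> bool) : compb b -> compb (fun t => ~~ b t).
Proof.
move=> cb; apply: (eq_comp (f := fun t => 1 - b t)); first by move=> t; case: (b t).
by apply: comp_sub => //; apply: comp_const.
Qed.

Lemma compb_and k (b c : ctx k -> bool) : compb b -> compb c -> compb (fun t => b t && c t).
Proof.
by move=> cb cc; apply: (eq_comp (f := fun t => b t * c t)) (comp_mul cb cc) => t; rewrite mulnb.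
Qed.

Lemma compb_or k (b c : ctx k -> bool) : compb b -> compb c -> compb (fun t => b t || c t).
Proof.
move=> cb cc; apply: (eq_compb (f := fun t => ~~ (~~ b t && ~~ c t))).
  by move=> t; rewrite negb_and !negbK.
by apply/compb_not/compb_and; apply: compb_not.
Qed.

Lemma compb_leq k f g : comp f -> comp g -> compb (fun t : ctx k => f t <= g t).
Proof.
move=> cf cg; apply: (eq_comp (f := fun t => 1 - (f t - g t))).
  by move=> t; rewrite /leq; case: (f t - g t).
by apply: comp_sub (comp_sub cf cg); apply: comp_const.
Qed.

Lemma compb_all k (N : ctx k -> nat) (F : ctx k -> nat -> bool) :
  comp N -> compb (fun t : ctx k.+1 => F t.2 t.1) ->
  compb (fun t => all (F t) (iota 0 (N t))).
Proof.
move=> cN cF; apply: (eq_compb (f := fun t => \sum_(0 <= i < N t) ~~ F t i <= 0)).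
  move=> t; rewrite leqn0 sum_nat_seq_eq0 /index_iota subn0; apply: eq_all => i.
  by case: (F t i).
apply: compb_leq; last exact: comp_const.
by apply: (comp_bsum (F := fun t i => ~~ F t i)) => //; apply: compb_not.
Qed.

Lemma compb_has k (N : ctx k -> nat) (F : ctx k -> nat -> bool) :
  comp N -> compb (fun t : ctx k.+1 => F t.2 t.1) ->
  compb (fun t => has (F t) (iota 0 (N t))).
Proof.
move=> cN cF; apply: (eq_compb (f := fun t => ~~ all (fun i => ~~ F t i) (iota 0 (N t)))).
  by move=> t; rewrite -has_predC; apply: eq_has => i /=; rewrite negbK.
by apply/compb_not/(compb_all (F := fun t i => ~~ F t i)) => //; apply: compb_not.
Qed.

Lemma comp_bprod k (N : ctx k -> nat) (F : ctx k -> nat -> nat) :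
  comp N -> comp (fun t : ctx k.+1 => F t.2 t.1) -> comp (fun t => \prod_(0 <= i < N t) F t i).
Proof.
move=> cN cF; apply: (eq_comp (f := fun t => natrec 1 (fun i r => r * F t i) (N t))).
  move=> t; elim: (N t) => [|n /= ->]; first by rewrite big_geq.
  by rewrite big_nat_recr.
apply: (comp_natrec (h := fun t i r => r * F t i)) => //; first exact: comp_const.
apply: comp_mul; first exact: comp_wk (comp_var0 _).
apply: (comp_subst (s := fun t : ctx k.+2 => (t.1, t.2.2) : ctx k.+1) cF).
exact: comps_cons (comp_var0 _) (comps_snd2 _).
Qed.

Lemma comp_div k f g : comp f -> comp g -> comp (fun t : ctx k => f t %/ g t).
Proof.
apply: comp_app2.
(* The first disjunct stops the search at 0 when the divisor is 0, which is the value of [%/]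
   there. *)
apply: (comp_mu (R := fun (t : ctx 2) q => (t.2.1 <= 0) || (t.1 < q.+1 * t.2.1))).
- apply: compb_or; apply: compb_leq.
  + exact: comp_wk (comp_wk (comp_var0 _)).
  + exact: comp_const.
  + exact: comp_succ (comp_wk (comp_var0 _)).
  + by apply: comp_mul; [apply: comp_succ; apply: comp_var0|exact: comp_wk (comp_wk (comp_var0 _))].
- by move=> [m [[|d] []]] //=; rewrite ltn_ceil.
- move=> [m [d []]] q /=; case: d => [|d]; first by rewrite divn0.
  by rewrite leq_divRL //= -leqNgt.
Qed.

Lemma comp_sqrt k f : comp f -> comp (fun t : ctx k => Nat.sqrt (f t)).
Proof.
apply: comp_app1.
apply: (comp_mu (R := fun (t : ctx 1) q => t.1 < q.+1 * q.+1)).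
- apply: compb_leq; first exact: comp_succ (comp_wk (comp_var0 _)).
  by apply: comp_mul; apply: comp_succ; apply: comp_var0.
- move=> [n []] /=; have := PeanoNat.Nat.sqrt_spec n; lia.
- move=> [n []] q /=; have := PeanoNat.Nat.sqrt_spec n; nia.
Qed.

(** * Cantor pairing and coded lists *)

Lemma comp_unpair1 k f : comp f -> comp (fun t : ctx k => (unpair (f t)).1).
Proof.
move=> cf; rewrite /unpair /=.
have c n := comp_const k n.
by do ?[apply: comp_sub|apply: comp_div|apply: comp_mul|apply: comp_succ|apply: comp_pred|
  apply: comp_sqrt|apply: comp_add].
Qed.

Lemma comp_unpair2 k f : comp f -> comp (fun t : ctx k => (unpair (f t)).2).
Proof.
move=> cf; rewrite /unpair /=.
have c n := comp_const k n.
by do ?[apply: comp_sub|apply: comp_div|apply: comp_mul|apply: comp_succ|apply: comp_pred|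
  apply: comp_sqrt|apply: comp_add].
Qed.

(** Entry [i] is the first component of what is left after [i] second projections; list access thus
    becomes primitive recursion on numbers. *)
Lemma nth_decode_list_aux k m i :
  nth 0 (decode_list_aux k m) i =
  if i < k then (unpair (iter i (fun x => (unpair x).2) m)).1 else 0.
Proof.
elim: k m i => [|k IH] m [|i] //.
rewrite /= IH ltnS; case: ifP => // _; congr (unpair _).1.
exact/esym/(iterSr i (fun x => (unpair x).2)).
Qed.

Lemma comp_decode_list k f i :
  comp f -> comp i -> comp (fun t : ctx k => nth 0 (decode_list (f t)) (i t)).
Proof.
move=> cf ci.
apply: (eq_comp (f := fun t => if i t < (unpair (f t)).1
  then (unpair (natrec (unpair (f t)).2 (fun _ r => (unpair r).2) (i t))).1 else 0)).
  move=> t; rewrite /decode_list nth_decode_list_aux; case: ifP => // _; congr (unpair _).1.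
  by elim: (i t) => //= n ->.
apply: comp_if; last exact: comp_const.
  by apply: compb_leq; [apply: comp_succ|apply: comp_unpair1].
apply: comp_unpair1; apply: (comp_natrec (h := fun _ _ r => (unpair r).2)) => //.
  exact: comp_unpair2.
by apply: comp_unpair2; apply: comp_wk (comp_var0 _).
Qed.

(** Surjectivity of the decoders is what makes the search through codes exhaustive. *)
Lemma unpair_surj a b : exists n, unpair n = (a, b).
Proof.
exists (((a + b) * (a + b).+1) %/ 2 + b); rewrite /unpair.
set w := a + b; set t := (w * w.+1) %/ 2.
have t2 : t * 2 = w * w.+1 by rewrite divnK // dvdn2 oddM /= andbN.
(* Here [8 * (t + b) + 1] equals [(2 * w + 1) ^ 2 + 8 * b], and [b <= w] keeps it below
   [(2 * w + 3) ^ 2]; the root is [2 * w + 1] or [2 * w + 2], and both give [w]. *)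
have -> : (Nat.sqrt (8 * (t + b) + 1)).-1 %/ 2 = w.
  have := PeanoNat.Nat.sqrt_spec (8 * (t + b) + 1).
  set s := Nat.sqrt _ => /(_ (le_0_n _)) [s1 s2].
  have bw : b <= w by rewrite leq_addl.
  have : w.*2.+1 <= s by nia.
  have : s <= w.*2.+2 by nia.
  lia.
by rewrite -/t; congr (_, _); lia.
Qed.

Lemma decode_list_surj (s : seq nat) : exists n, decode_list n = s.
Proof.
have [m mP] : exists m, decode_list_aux (size s) m = s.
  elim: s => [|x s [m mP]]; first by exists 0.
  have [n nP] := unpair_surj x m; exists n.
  rewrite -[LHS]/((unpair n).1 :: decode_list_aux (size s) (unpair n).2).
  by rewrite nP mP.
by have [n nP] := unpair_surj (size s) m; exists n; rewrite /decode_list nP.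
Qed.

Local Open Scope classical_set_scope.
Local Open Scope ring_scope.

(** * Rational-valued computable functions *)

Lemma decode_rat_surj (x : rat) : exists n, decode_rat n = x.
Proof.
have [a aP] : exists a, decode_int a = numq x.
  case: (numq x) => m; first by exists m.*2; rewrite /decode_int odd_double doubleK.
  by exists (m.*2.+1)%N; rewrite /decode_int /= odd_double /= doubleK NegzE.
have [n nP] := unpair_surj a (`|denq x|.-1)%N.
exists n; rewrite /decode_rat nP /= aP prednK ?absz_denq_gt0 //; last by rewrite absz_gt0 denq_neq0.
by rewrite -[in RHS](divq_num_den x); congr (_ / _); rewrite pmulrn gez0_abs ?denq_ge0.
Qed.

(* A rational-valued function is presented as a fraction (a - b) / c, so that
   only natural-number arithmetic is ever computed. *)
Definition compq k (f : ctx k -> rat) : Prop :=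
  exists a b c : ctx k -> nat, [/\ comp a, comp b, comp c &
    forall t, (0 < c t)%N /\ f t = ((a t)%:R - (b t)%:R) / (c t)%:R].

Lemma compq_const k n : compq (fun _ : ctx k => n%:R).
Proof.
exists (fun=> n), (fun=> 0%N), (fun=> 1%N); split; try exact: comp_const.
by move=> t; rewrite subr0 divr1.
Qed.

Lemma compq_opp k f : compq f -> compq (fun t : ctx k => - f t).
Proof.
move=> [a [b [c [ca cb cc E]]]]; exists b, a, c; split=> // t.
by have [c0 ->] := E t; split=> //; rewrite -mulNr opprB.
Qed.

Lemma compq_add k f g : compq f -> compq g -> compq (fun t : ctx k => f t + g t).
Proof.
move=> [a [b [c [ca cb cc E]]]] [a' [b' [c' [ca' cb' cc' E']]]].
exists (fun t => a t * c' t + a' t * c t)%N, (fun t => b t * c' t + b' t * c t)%N,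
  (fun t => c t * c' t)%N.
split; try by [apply: comp_add; apply: comp_mul|apply: comp_mul].
move=> t; have [c0 ->] := E t; have [c0' ->] := E' t; split; first by rewrite muln_gt0 c0.
rewrite !natrD !natrM; field; rewrite !pnatr_eq0; lia.
Qed.

Lemma compq_mul k f g : compq f -> compq g -> compq (fun t : ctx k => f t * g t).
Proof.
move=> [a [b [c [ca cb cc E]]]] [a' [b' [c' [ca' cb' cc' E']]]].
exists (fun t => a t * a' t + b t * b' t)%N, (fun t => a t * b' t + b t * a' t)%N,
  (fun t => c t * c' t)%N.
split; try by [apply: comp_add; apply: comp_mul|apply: comp_mul].
move=> t; have [c0 ->] := E t; have [c0' ->] := E' t; split; first by rewrite muln_gt0 c0.
rewrite !natrD !natrM; field; rewrite !pnatr_eq0; lia.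
Qed.

Lemma compb_ler k f g : compq f -> compq g -> compb (fun t : ctx k => f t <= g t).
Proof.
move=> [a [b [c [ca cb cc E]]]] [a' [b' [c' [ca' cb' cc' E']]]].
apply: (eq_compb (f := fun t => (a t * c' t + b' t * c t <= a' t * c t + b t * c' t)%N)).
  move=> t; have [c0 ->] := E t; have [c0' ->] := E' t.
  rewrite ler_pdivlMr ?ltr0n // mulrAC ler_pdivrMr ?ltr0n // !mulrBl lerBlDr addrAC lerBrDr.
  by rewrite -!natrM -!natrD ler_nat.
by apply: compb_leq; apply: comp_add; apply: comp_mul.
Qed.

Lemma compb_ltr k f g : compq f -> compq g -> compb (fun t : ctx k => f t < g t).
Proof.
move=> cf cg; apply: (eq_compb (f := fun t => ~~ (g t <= f t))).
  by move=> t; rewrite ltNge.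
exact: compb_not (compb_ler cg cf).
Qed.

Lemma compb_eqr k f g : compq f -> compq g -> compb (fun t : ctx k => f t == g t).
Proof.
move=> cf cg; apply: (eq_compb (f := fun t => (f t <= g t) && (g t <= f t))).
  by move=> t; rewrite eq_le.
by apply: compb_and; apply: compb_ler.
Qed.

(** The number of terms varies with the context, so [compq_add] cannot simply be repeated. All terms
    are brought over the product [D] of their denominators, which leaves bounded sums and products
    of naturals. *)
Lemma compq_sum k (N : ctx k -> nat) (F : ctx k -> nat -> rat) :
  comp N -> compq (fun t : ctx k.+1 => F t.2 t.1) ->
  compq (fun t => \sum_(0 <= i < N t) F t i).
Proof.
move=> cN [a [b [c [ca cb cc E]]]].
pose D t := (\prod_(0 <= i < N t) c (i, t))%N.
have cD : comp D.
  apply: (comp_bprod (F := fun t i => c (i, t))) => //.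
  by apply: eq_comp cc; case.
pose num (x : ctx k.+1 -> nat) t := (\sum_(0 <= i < N t) x (i, t) * (D t %/ c (i, t)))%N.
have cnum (x : ctx k.+1 -> nat) : comp x -> comp (num x).
  move=> cx; apply: (comp_bsum (F := fun t i => (x (i, t) * (D t %/ c (i, t)))%N)) => //.
  apply: comp_mul; first by apply: eq_comp cx; case.
  by apply: comp_div; [apply: comp_wk|apply: eq_comp cc; case].
have D0 t : (0 < D t)%N by apply: prodn_gt0 => i; have [] := E (i, t).
exists (num a), (num b), D; split; try by [apply: cnum|].
move=> t; split=> //.
rewrite /num !natr_sum -sumrB mulr_suml.
rewrite !big_nat; apply: eq_bigr => i /andP[_ iN].
have [c0 /= ->] := E (i, t).
rewrite !natrM -mulrBl -mulrA; congr (_ * _).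
have cD' : (c (i, t) %| D t)%N.
  by rewrite /D big_mkord (bigD1 (Ordinal iN)) //= dvdn_mulr.
have /(congr1 (fun n => n%:R : rat)) := divnK cD'; rewrite natrM => <-.
have : (0 < D t %/ c (i, t))%N by rewrite divn_gt0 // dvdn_leq.
rewrite -!(ltr0n rat) in c0 *; move: (_%:R) c0 => x x0 y0; field.
by rewrite !gt_eqF.
Qed.

Lemma compq_decode_rat k f : comp f -> compq (fun t : ctx k => decode_rat (f t)).
Proof.
move=> cf.
pose o t := (unpair (f t)).1; have co : comp o by apply: comp_unpair1.
have c n := comp_const k n.
have codd : compb (fun t => o t %/ 2 * 2 < o t)%N.
  by apply: compb_leq => //; apply: comp_succ; apply: comp_mul => //; apply: comp_div.
(* Odd codes stand for negative integers, so their absolute value goes to the subtracted part of the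
   numerator. *)
exists (fun t => if (o t %/ 2 * 2 < o t)%N then 0%N else o t %/ 2)%N,
  (fun t => if (o t %/ 2 * 2 < o t)%N then (o t).+1 %/ 2 else 0)%N,
  (fun t => (unpair (f t)).2.+1); split.
- by apply: comp_if => //; apply: comp_div.
- by apply: comp_if => //; apply: comp_div => //; apply: comp_succ.
- by apply: comp_succ; apply: comp_unpair2.
move=> t; split=> //; rewrite /decode_rat -/(o t); congr (_ / _).
rewrite /decode_int !divn2 muln2.
have -> : ((o t)./2.*2 < o t)%N = odd (o t) by lia.
by case: (odd _); rewrite ?subr0 ?sub0r ?rmorphN.
Qed.

(** * Rational solutions of the Bellman equation *)

(* At a minimiser [i] of [D], [D i >= l * D (s i) >= l * D i]. *)
Lemma discounted_ge0 (F : realFieldType) (S : finType) (l : F) (s : S -> S) (D : S -> F) :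
  0 <= l < 1 -> (forall i, l * D (s i) <= D i) -> forall i, 0 <= D i.
Proof.
move=> /andP[l0 l1] H i.
pose m := [arg min_(j < i) D j]%O.
have mP j : D m <= D j by rewrite /m; case: arg_minP => // k _; apply.
apply: le_trans (mP i).
have : l * D m <= D m by apply: le_trans (H m); apply: ler_wpM2l.
rewrite -subr_ge0 -{1}(mul1r (D m)) -mulrBl pmulr_rge0 // subr_gt0 //.
Qed.

(** In row-vector form the equation reads [V *m (1%:M - l *: P) = g], where [P] is transposed so
    that [v *m P] has entries [v (s i)]. A kernel vector satisfies [v i = l * v (s i)];
    [discounted_ge0], applied to [v] and to [- v], makes it zero. *)
Lemma policy_value_exists (F : realFieldType) n (l : F) (s : 'I_n -> 'I_n) (g : 'I_n -> F) :
  0 <= l < 1 -> exists V : 'I_n -> F, forall i, V i = g i + l * V (s i).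
Proof.
move=> hl; pose P : 'M[F]_n := \matrix_(i, j) (i == s j)%:R.
have vP (v : 'rV[F]_n) i : (v *m P) 0 i = v 0 (s i).
  rewrite mxE (bigD1 (s i)) //= mxE eqxx mulr1 big1 ?addr0 // => j js.
  by rewrite mxE (negbTE js) mulr0.
have vA (v : 'rV[F]_n) i : (v *m (1%:M - l *: P)) 0 i = v 0 i - l * v 0 (s i).
  by rewrite mulmxBr mulmx1 -scalemxAr mxE [X in _ + X]mxE [X in _ - X]mxE vP.
have u : 1%:M - l *: P \in unitmx.
  rewrite -row_free_unit; apply: inj_row_free => v v0.
  have E i : v 0 i = l * v 0 (s i).
    by apply/eqP; rewrite -subr_eq0 -vA v0 mxE.
  apply/rowP => i; rewrite mxE; apply/eqP; rewrite eq_le -oppr_ge0.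
  rewrite (discounted_ge0 (D := fun i => - v 0 i) (s := s) hl) /=; last first.
    by move=> j; rewrite mulrN -E.
  by apply: (discounted_ge0 (s := s) hl) => j; rewrite -E.
exists ((\row_i g i *m invmx (1%:M - l *: P)) 0) => i.
by apply/eqP; rewrite -subr_eq -vA mulmxKV // mxE.
Qed.

(* Among the finitely many positional policies, one whose values have maximal sum
   is optimal: a profitable one-step deviation at [q] would increase the value at
   [q] and decrease no other value. *)
Lemma bellman_exists (F : realFieldType) n (A : finType) (l : F) (nxt : A -> 'I_n)
    (edge : 'I_n -> A -> bool) (g : 'I_n -> A -> F) :
  0 <= l < 1 -> (forall q, exists a, edge q a) ->
  exists V : 'I_n -> F, forall q,
    (exists2 a, edge q a & V q = g q a + l * V (nxt a)) /\
    (forall a, edge q a -> g q a + l * V (nxt a) <= V q).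
Proof.
move=> hl hE.
have valB p : exists V : {ffun 'I_n -> F},
    [forall i, V i == g i (p i) + l * V (nxt (p i))].
  have [V VP] := policy_value_exists (fun i => nxt (p i)) (fun i => g i (p i)) hl.
  by exists (finfun V); apply/forallP => i; rewrite !ffunE VP.
pose val p := xchoose (valB p).
have val_eq p i : val p i = g i (p i) + l * val p (nxt (p i)).
  by apply/eqP; apply: (forallP (xchooseP (valB p)) i).
pose p0 := [ffun q => xchoose (hE q)].
pose ok (p : {ffun 'I_n -> A}) := [forall q, edge q (p q)].
have ok0 : ok p0 by apply/forallP => q; rewrite ffunE xchooseP.
case: (Order.TotalTheory.arg_maxP (fun p : {ffun 'I_n -> A} => \sum_q val p q) ok0) => p /forallP pE pmax.
exists (val p) => q; split; first by exists (p q).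
move=> a qa; rewrite leNgt; apply/negP => lt_val.
pose p' := [ffun i => if i == q then a else p i].
(* One step of [p'] reproduces [val p] except at [q], where it yields strictly more. Subtracted from
   the equation of [val p'], this gives the difference [D] of the values the hypothesis of
   [discounted_ge0], with a strict surplus at [q]. *)
have dev i : val p i + (if i == q then g q a + l * val p (nxt a) - val p q else 0)
    = g i (p' i) + l * val p (nxt (p' i)).
  rewrite ffunE; case: eqP => [->|_]; last by rewrite addr0 -val_eq.
  by rewrite addrC subrK.
have D0 : forall i, 0 <= val p' i - val p i.
  apply: (discounted_ge0 (s := fun i => nxt (p' i)) hl) => i.
  have := dev i; rewrite (val_eq p' i) mulrBr.
  case: ifP => _; move: lt_val; lra.
have Dq : 0 < val p' q - val p q.
  have := dev q; rewrite eqxx (val_eq p' q).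
  have := D0 (nxt (p' q)); case/andP: hl => l0 _.
  move=> /(mulr_ge0 l0); rewrite mulrBr; move: lt_val; lra.
have : ok p'.
  by apply/forallP => i; rewrite ffunE; case: eqP => [->|].
move=> /pmax /=; rewrite leNgt => /negP; apply.
rewrite -subr_gt0 -sumrB (bigD1 q) //=.
by apply: ltr_pwDl => //; apply: sumr_ge0.
Qed.

(** * Discounted sums *)

Definition bounded_seq (R : numDomainType) (x : nat -> R) : Prop := exists B, forall i, `|x i| <= B.

Lemma cvg_geometric_mul_bounded (R : realType) (l : R) (x : nat -> R) :
  0 < l < 1 -> bounded_seq x -> (fun n => l ^+ n * x n) @ \oo --> (0 : R).
Proof.
move=> /andP[l0 l1] [B xB].
have cB : (fun n => l ^+ n * B) @ \oo --> (0 : R).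
  rewrite -(mul0r B); apply: cvgMr_tmp; apply: cvg_expr; by rewrite ger0_norm // ltW.
have cBN : (fun n => - (l ^+ n * B)) @ \oo --> (0 : R).
  by rewrite -oppr0; apply: cvgN.
apply: (squeeze_cvgr _ cBN cB); near=> n.
by rewrite -ler_norml normrM normrX (gtr0_norm l0) ler_wpM2l ?exprn_ge0 // ltW.
Unshelve. all: by end_near.
Qed.

Definition dsum (R : realType) (l : R) (v : nat -> R) : R :=
  limn (series (fun i => l ^+ i * v i)).

Lemma is_cvg_dsum (R : realType) (l : R) (v : nat -> R) :
  0 < l < 1 -> bounded_seq v -> cvgn (series (fun i => l ^+ i * v i)).
Proof.
move=> /andP[l0 l1] [B vB]; apply: normed_cvg.
apply: (series_le_cvg (v_ := fun i => B * l ^+ i)).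
- by move=> n; apply: normr_ge0.
- by move=> n; apply: mulr_ge0; [apply: le_trans (vB 0%N)|rewrite exprn_ge0 // ltW].
- by move=> n; rewrite /= normrM normrX (gtr0_norm l0) mulrC ler_wpM2r ?exprn_ge0 // ltW.
- by apply: is_cvg_geometric_series; rewrite ger0_norm // ltW.
Qed.

(* Summation by telescoping: [sum_(i < n) l^i (x_i - l x_(i+1)) = x_0 - l^n x_n]. *)
Lemma dsum_le (R : realType) (l : R) (v x : nat -> R) :
  0 < l < 1 -> bounded_seq v -> bounded_seq x ->
  (forall i, v i <= x i - l * x i.+1) -> dsum l v <= x 0%N.
Proof.
move=> hl bv bx vx.
have hN n : series (fun i => l ^+ i * v i) n <= x 0%N - l ^+ n * x n.
  elim: n => [|n IH]; first by rewrite /series /= big_geq // expr0 mul1r subrr.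
  rewrite /series /= big_nat_recr //=.
  apply: le_trans (lerD IH (ler_wpM2l _ (vx n))) _; first by rewrite exprn_ge0 //; lra.
  rewrite exprS; lra.
have cx : (fun n => x 0%N - l ^+ n * x n) @ \oo --> x 0%N.
  rewrite -[X in _ --> X]subr0; apply: cvgB; first exact: cvg_cst.
  exact: cvg_geometric_mul_bounded.
rewrite -(cvg_lim _ cx) //; apply: ler_lim; first exact: is_cvg_dsum.
  by apply/cvg_ex; exists (x 0%N).
by near=> n; apply: hN.
Unshelve. all: by end_near.
Qed.

Lemma dsumN (R : realType) (l : R) (v : nat -> R) :
  0 < l < 1 -> bounded_seq v -> dsum l (fun i => - v i) = - dsum l v.
Proof.
move=> hl bv; rewrite /dsum -limN; last exact: is_cvg_dsum.
congr (limn _); apply/funext => n; rewrite -[RHS]/(- series _ n) /series /= -sumrN.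
by apply: eq_bigr => i _; rewrite mulrN.
Qed.

Lemma bounded_seqN (R : realType) (x : nat -> R) : bounded_seq x -> bounded_seq (fun i => - x i).
Proof. by move=> [B xB]; exists B => i; rewrite normrN. Qed.

Lemma dsum_ge (R : realType) (l : R) (v x : nat -> R) :
  0 < l < 1 -> bounded_seq v -> bounded_seq x ->
  (forall i, x i - l * x i.+1 <= v i) -> x 0%N <= dsum l v.
Proof.
move=> hl bv bx vx; rewrite -lerN2 -dsumN //.
apply: (dsum_le (x := fun i => - x i)); [by []|exact: bounded_seqN..|].
by move=> i; have := vx i; lra.
Qed.

(** The first [n] terms telescope to [x 0 - l ^+ n * x n], where [x n <= B], and the remaining terms
    contribute at least [- l ^+ n * (B / (1 - l))]. *)
Lemma dsum_prefix_ge (R : realType) (l B : R) (v x : nat -> R) n :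
  0 < l < 1 -> (forall i, `|v i| <= B) -> (forall i, `|x i| <= B) ->
  (forall i, (i < n)%N -> v i = x i - l * x i.+1) ->
  x 0%N - l ^+ n * (B + B / (1 - l)) <= dsum l v.
Proof.
move=> hl bv bx vx.
have B0 : 0 <= B by apply: le_trans (bv 0%N).
have K0 : 0 <= B / (1 - l) by apply: divr_ge0 => //; lra.
set K := B / (1 - l) in K0 *.
have KE : K - l * K = B by rewrite /K; field; lra.
(* follow the potential [x] up to time [n], then the constant lower bound [- K] *)
pose z i := if (i < n)%N then x i - l ^+ (n - i) * (x n + K) else - K.
have p01 m : 0 <= l ^+ m <= 1 by rewrite exprn_ge0 ?exprn_ile1 //; lra.
have bz : bounded_seq z.
  exists (B + (B + K)) => i; rewrite /z; case: ifP => _; last by rewrite normrN ger0_norm //; lra.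
  apply: le_trans (ler_normB _ _) _; apply: lerD => //.
  rewrite normrM ger0_norm; last by case/andP: (p01 (n - i)%N).
  rewrite -[leRHS]mul1r; apply: ler_pM => //; try by case/andP: (p01 (n - i)%N).
  by apply: le_trans (ler_normD _ _) _; apply: lerD => //; rewrite ger0_norm.
have z0 : x 0%N - l ^+ n * (B + K) <= z 0%N.
  rewrite /z; case: posnP => [->|n0]; first by have := bx 0%N; rewrite expr0 ler_norml; lra.
  rewrite subn0 lerB // ler_wpM2l //; first by case/andP: (p01 n).
  by have := bx n; rewrite ler_norml; lra.
apply: le_trans z0 _; apply: dsum_ge => //; first by exists B.
move=> i; rewrite /z.
(* The correction in [z] is scaled so as to cancel in [z i - l * z i.+1], also where [z] switches at
   [n]; from [n] on this difference is [- B]. *)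
case: (ltngtP i n) => [lt_in|gt_in|eq_in].
- rewrite vx //; case: ltnP => [lt_Sin|ge_Sin].
    have -> : (n - i = (n - i.+1).+1)%N by lia.
    by rewrite exprS; lra.
  have -> : n = i.+1 by lia.
  by rewrite subSnn expr1; lra.
- by rewrite ltnNge ltnW ?leqW //= 1?ltnW //; have := bv i; rewrite ler_norml; lra.
- by rewrite ltnNge leqW ?eq_in //=; have := bv n; rewrite ler_norml; lra.
Qed.

Lemma Disc_dsum (l : RR) (v : nat -> RR) : Disc l v = dsum l v.
Proof. by []. Qed.

(** * Cylinder probabilities *)

Definition step_prob (I : pwa_instance) (w : nat -> nat) (i q q' : nat) : RR :=
  if (q' < nst I)%N then ratr (delta I q (w i) q') else 0.

(** Conditional probability of continuing [v] by [q]. It lets prefixes grow at their end, whereas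
    [prefix_prob] recurses from the front. *)
Definition ext_prob (I : pwa_instance) (w : nat -> nat) (v : seq nat) (q : nat) : RR :=
  if v is q0 :: v' then step_prob I w (size v') (last q0 v') q
  else if (q < nst I)%N then ratr (init I q) else 0.

Lemma prefix_prob_aux_rcons I w i q v q' :
  prefix_prob_aux I w i q (rcons v q') =
  prefix_prob_aux I w i q v * step_prob I w (i + size v) (last q v) q'.
Proof.
elim: v i q => [|x v IH] i q /=; first by rewrite addn0 mulrC.
by rewrite IH addSnnS mulrA.
Qed.

Lemma prefix_prob_rcons I w v q :
  prefix_prob I w (rcons v q) = prefix_prob I w v * ext_prob I w v q.
Proof.
by case: v => [|q0 v] /=; [rewrite mulrC|rewrite prefix_prob_aux_rcons mulrA].
Qed.

Lemma ext_prob_mkseq I w (r : nat -> nat) n q :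
  ext_prob I w (mkseq r n.+1) q = step_prob I w n (r n) q.
Proof.
rewrite /= size_map size_iota; congr step_prob.
by rewrite last_map (last_nth 0%N) size_iota -[_ :: _]/(iota 0 n.+1) nth_iota.
Qed.

Lemma prefix_rconsE (T : eqType) (x v : seq T) q :
  prefix x (rcons v q) = prefix x v || (x == rcons v q).
Proof.
elim: v x => [|a v IH] [|b x]; rewrite ?prefix0s // [rcons _ _]/= eqseq_cons !prefix_cons.
by rewrite IH andb_orr.
Qed.

Section Prob.
Variables (I : pwa_instance) (w : nat -> nat).
Hypotheses (wfI : wf I) (wI : is_word I w).

Local Notation P := (prefix_prob I w).

Let all_lt (v : seq nat) := all (fun q => q < nst I)%N v.

Lemma prefix_prob_out (v : seq nat) : ~~ all_lt v -> P v = 0.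
Proof.
elim/last_ind: v => // v q IH; rewrite /all_lt all_rcons prefix_prob_rcons negb_and.
case/orP => [/negbTE qn|/IH ->]; last by rewrite mul0r.
by case: v {IH} => [|q0 v]; rewrite /= /step_prob qn mulr0.
Qed.

Lemma ext_prob_ge0 (v : seq nat) q : all_lt v -> 0 <= ext_prob I w v q.
Proof.
case: wfI => i0 _ d0 _ _; case: v => [|q0 v] vlt /=; rewrite /step_prob; case: ifP => // qn.
  by rewrite ler0q i0.
rewrite ler0q d0 //; have := mem_last q0 v; exact: (allP vlt).
Qed.

Lemma ext_prob_sum (v : seq nat) : all_lt v -> \sum_(q < nst I) ext_prob I w v q = 1.
Proof.
case: wfI => _ i1 _ d1 _; case: v => [|q0 v] vlt /=; rewrite /step_prob.
  by under eq_bigr do rewrite ltn_ord; rewrite -rmorph_sum i1 rmorph1.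
under eq_bigr do rewrite ltn_ord; rewrite -rmorph_sum d1 ?rmorph1 //.
have := mem_last q0 v; exact: (allP vlt).
Qed.

Lemma prefix_prob_ge0 (v : seq nat) : 0 <= P v.
Proof.
elim/last_ind: v => // v q IH; rewrite prefix_prob_rcons.
have [vlt|vn] := boolP (all_lt v); last by rewrite prefix_prob_out // mul0r.
by rewrite mulr_ge0 // ext_prob_ge0.
Qed.

(** Kolmogorov consistency of the cylinder probabilities; if [v] leaves the state set, both sides
    vanish. *)
Lemma prefix_prob_sum (v : seq nat) : \sum_(q < nst I) P (rcons v q) = P v.
Proof.
under eq_bigr do rewrite prefix_prob_rcons; rewrite -mulr_sumr.
have [vlt|vn] := boolP (all_lt v); last by rewrite prefix_prob_out // mul0r.
by rewrite ext_prob_sum // mulr1.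
Qed.

Lemma prefix_prob_run_gt0 r n : is_run I w r -> 0 < P (mkseq r n).
Proof.
move=> [rlt [r0 rS]]; elim: n => [|n IH]; first exact: ltr01.
rewrite mkseqS prefix_prob_rcons mulr_gt0 //.
by case: n {IH} => [|n]; rewrite ?ext_prob_mkseq /= /step_prob rlt ltr0q.
Qed.

(** Converse of [prefix_prob_run_gt0]; it recognises the limit sequence built in [prob_ge] as a
    run. *)
Lemma gt0_prefix_prob_run r : (forall n, 0 < P (mkseq r n)) -> is_run I w r.
Proof.
move=> rP.
have rlt i : (r i < nst I)%N.
  apply: contraTT (rP i.+1) => ri; rewrite prefix_prob_out ?ltxx //.
  by rewrite mkseqS /all_lt all_rcons negb_and ri.
split=> //; split.
  by have := rP 1%N; rewrite /= rlt mulr1 ltr0q.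
move=> i; have := rP i.+2.
rewrite mkseqS prefix_prob_rcons ext_prob_mkseq pmulr_rgt0 //.
by rewrite /step_prob rlt ltr0q.
Qed.

(* [meet x v] is the probability of the intersection of the cylinders of [x] and [v]. *)
Let meet (x v : seq nat) : RR := if prefix v x then P x else if prefix x v then P v else 0.

Lemma prefix_prob_prefix v x : prefix v x -> P x <= P v.
Proof.
move=> /prefixP[s ->{x}]; elim/last_ind: s => [|s q IH]; first by rewrite cats0.
apply: le_trans IH; rewrite -rcons_cat -[leRHS]prefix_prob_sum.
have [qlt|qn] := boolP (q < nst I)%N.
  rewrite (bigD1 (Ordinal qlt)) //= lerDl; apply: sumr_ge0 => *; exact: prefix_prob_ge0.
rewrite prefix_prob_out; last by rewrite /all_lt all_rcons negb_and qn.
by apply: sumr_ge0 => *; exact: prefix_prob_ge0.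
Qed.

Lemma meet_ge0 x v : 0 <= meet x v.
Proof. by rewrite /meet; do 2?case: ifP => _ //; apply: prefix_prob_ge0. Qed.

Lemma meet_le x v : meet x v <= P x.
Proof.
rewrite /meet; case: ifP => // _; case: ifP => [|_]; first exact: prefix_prob_prefix.
exact: prefix_prob_ge0.
Qed.

(** If [x] is a prefix of [v], this is [prefix_prob_sum]. If [v] is a proper prefix of [x], only the
    child of [v] towards [x] contributes, and when that child is not a state, [P x] is 0. *)
Lemma meet_sum x (v : seq nat) : \sum_(q < nst I) meet x (rcons v q) = meet x v.
Proof.
have [/prefixP[s ->{x}]|vx] := boolP (prefix v x); last first.
  rewrite [RHS]/meet (negbTE vx).
  have nvx q : prefix (rcons v q) x = false.
    by apply/negbTE; apply: contra vx; apply: prefix_trans; exact: prefix_rcons.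
  have [xv|xv] := boolP (prefix x v).
    rewrite -prefix_prob_sum; apply: eq_bigr => q _; rewrite /meet nvx.
    by rewrite (prefix_trans xv (prefix_rcons _ _)).
  apply: big1 => q _; rewrite /meet nvx prefix_rconsE (negbTE xv).
  by case: eqP => // xE; rewrite xE prefix_rcons in vx.
rewrite [RHS]/meet prefix_prefix; case: s => [|a s].
  rewrite cats0 -[RHS]prefix_prob_sum; apply: eq_bigr => q _; rewrite /meet prefix_rcons.
  by case: ifP => // /size_prefix; rewrite size_rcons ltnn.
have E (q : 'I_(nst I)) : meet (v ++ a :: s) (rcons v q) = if q == a :> nat then P (v ++ a :: s) else 0.
  rewrite /meet -cats1 !prefix_catr // !eqxx /= prefix0s andbT.
  by rewrite (eq_sym a); case: eqP.
under eq_bigr do rewrite E.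
have [alt|an] := boolP (a < nst I)%N.
  rewrite (bigD1 (Ordinal alt)) //= eqxx big1 ?addr0 // => q qa.
  by case: eqP => // qE; case/eqP: qa; apply: val_inj.
rewrite prefix_prob_out; last by rewrite /all_lt all_cat /= (negbTE an) andbF.
by apply: big1 => q _; case: ifP.
Qed.

(* A cover of total mass below [P u] would leave, at every level, an extension of [u]
   whose mass exceeds that of its traces on the cover; the run obtained in the limit
   is missed by all cylinders of the cover. *)
Lemma prob_ge u E : cyl u `&` is_run I w `<=` E -> ((P u)%:E <= prob I w E)%E.
Proof.
move=> uE; apply: le_ereal_inf_tmp => _ [f [Ef ->]].
rewrite leNgt; apply/negP => lt_fu.
pose S (v : seq nat) := (\sum_(i <oo) (meet (f i) v)%:E)%E.
have S_sum (v : seq nat) : S v = (\sum_(q < nst I) S (rcons v q))%E.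
  rewrite /S -nneseries_sum; last by move=> q j _; rewrite lee_fin meet_ge0.
  by apply: eq_eseriesr => i _; rewrite sumEFin meet_sum.
have Su : (S u < (P u)%:E)%E.
  apply: le_lt_trans lt_fu; apply: lee_nneseries => i *; rewrite lee_fin ?meet_ge0 //.
  exact: meet_le.
have step v : (S v < (P v)%:E)%E -> {q | (S (rcons v q) < (P (rcons v q))%:E)%E}.
  move=> Sv; apply: cid; apply: contrapT => noq.
  move: Sv; rewrite ltNge => /negP; apply.
  rewrite -prefix_prob_sum -sumEFin S_sum; apply: lee_sum => q _.
  by rewrite leNgt; apply/negP => lt_q; apply: noq; exists q.
(* The default 0 is never taken along [words], by the invariant [wordsP]. *)
pose next v := if pselect (S v < (P v)%:E)%E is left h then sval (step v h) else 0%N.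
pose words n := iter n (fun v => rcons v (next v)) u.
have wordsP n : (S (words n) < (P (words n))%:E)%E.
  elim: n => //= n IH; rewrite {1 2}/next; case: pselect => // h.
  exact: svalP (step _ h).
pose r i := nth 0%N (words i.+1) i.
have size_words n : size (words n) = (size u + n)%N.
  by elim: n => [|n IH]; rewrite ?addn0 //= size_rcons IH addnS.
have words_prefix m n : (m <= n)%N -> prefix (words m) (words n).
  move=> /subnK <-; elim: (n - m)%N => [|k IH]; first exact: prefix_refl.
  exact: prefix_trans IH (prefix_rcons _ _).
have rE m i : (i < size (words m))%N -> r i = nth 0%N (words m) i.
  move=> im; rewrite /r; have [mi|im'] := leqP m i.+1.
    by have /prefixP[s ->] := words_prefix _ _ mi; rewrite nth_cat im.
  have /prefixP[s ->] := words_prefix _ _ (ltnW im'); rewrite nth_cat size_words.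
  by case: ifP => //; lia.
have rW m : words m = mkseq r (size (words m)).
  apply: (eq_from_nth (x0 := 0%N)) => [|i im]; first by rewrite size_mkseq.
  by rewrite nth_mkseq // (rE m).
have rrun : is_run I w r.
  apply: gt0_prefix_prob_run => n.
  have /prefix_prob_prefix : prefix (mkseq r n) (words n).
    by rewrite [words n]rW size_words addnC /mkseq iotaD map_cat prefix_prefix.
  apply: lt_le_trans; rewrite -lte_fin; apply: le_lt_trans (wordsP n).
  by apply: nneseries_ge0 => i *; rewrite lee_fin meet_ge0.
have /Ef[i _ fir] : E r.
  by apply: uE; split=> // i iu; rewrite (rE 0%N).
(* At this level the word is at least as long as [f i] and both follow [r], so the single term [i]
   of the cover already accounts for all of [P v], against the invariant. *)
have := wordsP (size (f i)); set v := words _; apply/negP; rewrite -leNgt.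
have -> : P v = meet (f i) v.
  rewrite /meet.
  have fv : prefix (f i) v.
    rewrite prefixE /v rW size_words -[take _ _]map_take take_iota.
    rewrite (minn_idPl _) ?leq_addl //; apply/eqP/(eq_from_nth (x0 := 0%N)).
      by rewrite size_map size_iota.
    by move=> j; rewrite size_map size_iota => jf; rewrite nth_mkseq // fir.
  rewrite fv; case: ifP => // /prefixP[s fE]; move: fv; rewrite fE => /size_prefix.
  by rewrite size_cat; case: s {fE} => [|? ?]; rewrite ?cats0 //=; lia.
rewrite /S.
apply: le_trans (nneseries_lim_ge i.+1 _) => [|j _]; last by rewrite lee_fin meet_ge0.
rewrite big_nat_recr //= leeDr // sume_ge0 // => j _; by rewrite lee_fin meet_ge0.
Qed.

(* [nst I] is not a state, so the cylinder of [[:: nst I]] is null. *)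
Lemma prob_le_sum (s : seq (seq nat)) E :
  (forall r, E r -> exists2 v, v \in s & cyl v r) ->
  (prob I w E <= (\sum_(v <- s) P v)%:E)%E.
Proof.
move=> Es; pose f := nth [:: nst I] s.
apply: ge_ereal_inf; exists (\sum_(i <oo) (P (f i))%:E)%E.
  exists f; split=> // r /Es[v vs vr]; exists (index v s) => //.
  by rewrite /f nth_index.
have P0 : P [:: nst I] = 0 by apply: prefix_prob_out; rewrite /all_lt /= ltnn.
rewrite (nneseries_split 0 (size s)); last by move=> k _; rewrite lee_fin prefix_prob_ge0.
rewrite add0n eseries0 ?adde0; last first.
  by move=> i si _; rewrite /f nth_default ?P0.
by rewrite sumEFin (big_nth [:: nst I]).
Qed.

Lemma prob_le1 E : (prob I w E <= 1)%E.
Proof.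
have := @prob_le_sum [:: [::]] E; rewrite big_seq1; apply=> r _.
by exists [::]; rewrite ?inE.
Qed.

Lemma prob_set0 : (prob I w set0 = 0)%E.
Proof.
apply/eqP; rewrite eq_le; apply/andP; split.
  by have := @prob_le_sum [::] set0; rewrite big_nil; apply=> r [].
apply: le_ereal_inf_tmp => _ [f [_ ->]]; apply: nneseries_ge0 => i _ _.
by rewrite lee_fin prefix_prob_ge0.
Qed.

(** An upper bound on an infimum over covers needs just one cover: the words of length [n] over the
    states, whose masses add up to 1, without [mkseq r n]. *)
Lemma prob_le_compl r n E :
  is_run I w r -> E `<=` is_run I w -> (forall r', E r' -> ~ cyl (mkseq r n) r') ->
  (prob I w E <= (1 - P (mkseq r n))%:E)%E.
Proof.
move=> [rlt _] Erun Ecyl.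
pose words k := iter k (fun s => [seq rcons v q | v <- s, q <- iota 0 (nst I)]) [:: [::]].
have words_sum k : \sum_(v <- words k) P v = 1.
  elim: k => [|k IH] /=; first by rewrite big_seq1.
  rewrite big_allpairs_dep /= -[RHS]IH; apply: eq_bigr => v _.
  by rewrite -(prefix_prob_sum v) -(big_mkord xpredT (fun q => P (rcons v q))) /index_iota subn0.
have words_mem r' k : (forall i, r' i < nst I)%N -> mkseq r' k \in words k.
  move=> r'lt; elim: k => [|k IH] //=; rewrite mkseqS.
  by apply: allpairs_f => //; rewrite mem_iota /=.
have -> : 1 - P (mkseq r n) = \sum_(v <- rem (mkseq r n) (words n)) P v.
  by rewrite -(words_sum n) (big_rem _ (words_mem r n rlt)) /= addrAC subrr add0r.
apply: prob_le_sum => r' Er'; have [r'lt _] := Erun _ Er'.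
exists (mkseq r' n); last by move=> i; rewrite size_mkseq => i_n; rewrite nth_mkseq.
have : mkseq r' n \in words n by exact: words_mem.
rewrite (perm_mem (perm_to_rem (words_mem r n rlt))) inE => /orP[/eqP rr'|//].
case: (Ecyl r' Er') => i; rewrite size_mkseq => i_n.
by rewrite -rr' nth_mkseq.
Qed.
End Prob.

(** * Reduction to the Bellman equation *)

Definition edge (I : pwa_instance) (q a q' : nat) : bool :=
  [&& (a < nal I)%N, (q' < nst I)%N & 0 < delta I q a q'].

Definition bellman (I : pwa_instance) (g : nat -> nat -> nat -> rat) (V : nat -> rat) : Prop :=
  forall q, (q < nst I)%N ->
    (exists a q', edge I q a q' /\ V q = g q a q' + lam I * V q') /\
    (forall a q', edge I q a q' -> g q a q' + lam I * V q' <= V q).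

Lemma eq_bellman I g V V' :
  (forall q, (q < nst I)%N -> V q = V' q) -> bellman I g V -> bellman I g V'.
Proof.
move=> VV' bV q qn; have [[a [q' [e E]]] le] := bV q qn; split.
  exists a, q'; split=> //; rewrite -!VV' //.
  by case/and3P: e.
by move=> b p e'; rewrite -!VV' ?le //; case/and3P: e'.
Qed.

Lemma exists_bellman I g : wf I -> (0 < nal I)%N -> exists V, bellman I g V.
Proof.
move=> [_ _ _ d1 /andP[l0 l1]] nal0.
(* The row of letter 0 sums to 1 and so has a positive entry; this is where the alphabet must be
   nonempty. *)
have hE (q : 'I_(nst I)) : exists p : 'I_(nal I) * 'I_(nst I), 0 < delta I q p.1 p.2.
  apply/existsP; apply: contraT; rewrite negb_exists => /forallP H.
  have : \sum_(q' < nst I) delta I q 0 q' <= 0.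
    by apply: sumr_le0 => q' _; rewrite leNgt; apply: (H (Ordinal nal0, q')).
  by rewrite d1 ?ler10.
have hl : 0 <= lam I < 1 by rewrite ltW.
have [V VP] := bellman_exists snd
  (fun (q : 'I_(nst I)) (p : 'I_(nal I) * 'I_(nst I)) => g q p.1 p.2) hl hE.
exists (fun q => if insub q is Some q' then V q' else 0) => q qn.
have VE (p : 'I_(nst I)) : (if insub (p : nat) is Some p' then V p' else 0) = V p.
  by rewrite valK.
have [[[a q'] e E] le] := VP (Ordinal qn); split.
  by exists a, q'; rewrite /edge !ltn_ord (VE (Ordinal qn)) VE.
move=> b p /and3P[bn pn e']; rewrite (VE (Ordinal qn)) (VE (Ordinal pn)).
exact: (le (Ordinal bn, Ordinal pn)).
Qed.

(** Convertible to [weight_seq] for [gamma I]; the general form also serves [- gamma]. *)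
Definition gain_seq (g : nat -> nat -> nat -> rat) (w r : nat -> nat) : nat -> RR :=
  fun i => ratr (g (r i) (w i) (r i.+1)).

Lemma finite_bounded (T : finType) (F : T -> RR) : exists B, forall t, `|F t| <= B.
Proof.
exists (\sum_t `|F t|) => t; rewrite (bigD1 t) //= lerDl.
by apply: sumr_ge0.
Qed.

Lemma expr_lt_eventually (l C e : RR) : 0 < l < 1 -> 0 < e -> exists n, l ^+ n * C < e.
Proof.
move=> hl e0.
have bC : bounded_seq (fun _ : nat => C) by exists `|C|.
have /cvgr_lt /(_ _ e0) [n _ nP] := cvg_geometric_mul_bounded hl bC.
by exists n; apply: nP => /=.
Qed.

(** * Runs measured against a solution of the Bellman equation *)

Section Runs.
Variables (I : pwa_instance) (g : nat -> nat -> nat -> rat) (V : nat -> rat).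
Hypotheses (wfI : wf I) (bV : bellman I g V).
Let l : RR := ratr (lam I).

Lemma ratr_lam : 0 < l < 1.
Proof.
have r1 : ratr 1 = 1 :> RR by rewrite rmorph1.
by case: wfI => _ _ _ _; rewrite /l ltr0q -r1 ltr_rat.
Qed.

Lemma run_bounded : exists B : RR, forall w r, is_word I w -> is_run I w r -> forall i,
  `|gain_seq g w r i| <= B /\ `|ratr (V (r i)) : RR| <= B.
Proof.
have [B1 B1P] := finite_bounded (fun p : 'I_(nst I) * 'I_(nal I) * 'I_(nst I) =>
  ratr (g p.1.1 p.1.2 p.2)).
have [B2 B2P] := finite_bounded (fun q : 'I_(nst I) => ratr (V q)).
exists (Num.max B1 B2) => w r wI [rn _] i; rewrite !le_max.
split; apply/orP; [left|right].
  exact: (B1P (Ordinal (rn i), Ordinal (wI i), Ordinal (rn i.+1))).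
exact: (B2P (Ordinal (rn i))).
Qed.

Lemma run_bounded_gain w r : is_word I w -> is_run I w r -> bounded_seq (gain_seq g w r).
Proof. by move=> wI rr; have [B BP] := run_bounded; exists B => i; case: (BP w r wI rr i). Qed.

Lemma run_Disc_le w r :
  is_word I w -> is_run I w r -> Disc l (gain_seq g w r) <= ratr (V (r 0)).
Proof.
move=> wI rr; have [B BP] := run_bounded.
rewrite Disc_dsum; apply: (dsum_le (x := fun i => ratr (V (r i)))) => //; first exact: ratr_lam.
- exact: run_bounded_gain.
- by exists B => i; case: (BP w r wI rr i).
move=> i; case: rr => rn [_ rd].
have [_ /(_ (w i) (r i.+1))] := bV (rn i).
rewrite /edge wI rn rd => /(_ isT).
by rewrite -(ler_rat RR) rmorphD rmorphM /= -/l lerBrDr.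
Qed.

(** Tightness of the Bellman inequality at every step; by telescoping, a run of this kind has
    discounted sum [V (r 0)]. *)
Definition greedy (w r : nat -> nat) : Prop :=
  forall i, V (r i) = g (r i) (w i) (r i.+1) + lam I * V (r i.+1).

Lemma exists_greedy q0 : (q0 < nst I)%N -> 0 < init I q0 ->
  exists w r, [/\ is_word I w, is_run I w r, r 0 = q0 & greedy w r].
Proof.
move=> q0n q0i.
have /choice[f fP] : forall q, exists p : nat * nat, (q < nst I)%N ->
    edge I q p.1 p.2 /\ V q = g q p.1 p.2 + lam I * V p.2.
  move=> q; have [qn|] := boolP (q < nst I)%N; last by exists (0%N, 0%N).
  by have [[a [q' H]] _] := bV qn; exists (a, q').
pose r i := iter i (fun q => (f q).2) q0.
have rn i : (r i < nst I)%N.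
  elim: i => //= i IH; by have [/and3P[]] := fP _ IH.
exists (fun i => (f (r i)).1), r; split=> //.
- by move=> i; have [/and3P[]] := fP _ (rn i).
- split=> //; split=> // i; by have [/and3P[]] := fP _ (rn i).
- by move=> i; have [_] := fP _ (rn i).
Qed.

(** The greedy run alone may be a null set, so near-optimality is extended to every run of a
    cylinder around it. *)
Lemma greedy_neighbourhood w r e : is_word I w -> greedy w r -> 0 < e ->
  exists n, forall r', is_run I w r' -> cyl (mkseq r n) r' ->
    ratr (V (r 0)) - e <= Disc l (gain_seq g w r').
Proof.
move=> wI gr e0; have [B BP] := run_bounded.
have [n /ltW nP] := expr_lt_eventually (B + B / (1 - l)) ratr_lam e0.
(* The gain at time [i] reads the state at time [i.+1], so the first [n] gains are fixed by [n.+1]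
   states. *)
exists n.+1 => r' rr' r'r.
have r'E i : (i <= n)%N -> r' i = r i.
  by move=> i_n; rewrite r'r ?size_mkseq // nth_mkseq.
rewrite Disc_dsum -(r'E 0%N) //.
apply: le_trans (dsum_prefix_ge (B := B) (x := fun i => ratr (V (r' i))) (n := n) ratr_lam _ _ _).
- by rewrite lerB.
- by move=> i; case: (BP w r' wI rr' i).
- by move=> i; case: (BP w r' wI rr' i).
move=> i i_n; rewrite /gain_seq !r'E //; last exact: ltnW.
by rewrite gr rmorphD rmorphM /= addrK.
Qed.
End Runs.

(** An event of positive probability contains a run, whose sum [V] bounds. Conversely, for each [e]
    the event at [V q0 - e] contains all runs of a cylinder of positive mass. *)
Lemma PosDisc_bellman I V : wf I -> (0 < nal I)%N -> bellman I (gamma I) V ->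
  PosDisc_nonempty I <-> exists q, [/\ (q < nst I)%N, 0 < init I q & nu I <= V q].
Proof.
move=> wfI nal0 bV; split; last first.
  move=> [q0 [q0n q0i q0V]]; split=> //.
  have [w [r [wI rr r0 gr]]] := exists_greedy bV q0n q0i.
  exists w; split=> //; apply: (@le_trans _ _ (ratr (V q0))%:E).
    by rewrite lee_fin ler_rat.
  apply/lee_addgt0Pr => e e0; rewrite -leeBlDr // -EFinB.
  have [n nP] := greedy_neighbourhood wfI wI gr e0.
  apply: ereal_sup_ubound; exists (ratr (V q0) - e) => //=.
  apply: (@lt_le_trans _ _ (prefix_prob I w (mkseq r n))%:E).
    by rewrite lte_fin prefix_prob_run_gt0.
  apply: prob_ge => // r' [r'r rr']; split=> //.
  by rewrite -r0; apply: nP.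
move=> [_ [w [wI nuL]]].
have [q0 q0i] : exists q0 : 'I_(nst I), 0 < init I q0.
  apply/existsP; apply: contraT; rewrite negb_exists => /forallP H.
  case: wfI => _ i1 _ _ _; have : \sum_(q < nst I) init I q <= 0.
    by apply: sumr_le0 => q _; rewrite leNgt.
  by rewrite i1 ler10.
(* Different thresholds may be witnessed by runs from different initial states; the best initial
   state dominates them all. *)
case: (Order.TotalTheory.arg_maxP (P := fun q : 'I_(nst I) => 0 < init I q)
  (fun q : 'I_(nst I) => V q) q0i) => q qi qmax.
exists q; split=> //; rewrite -(ler_rat RR) -lee_fin; apply: le_trans nuL _.
apply: ge_ereal_sup => _ [eta /= eta0 <-].
have [r [rr etar]] : event I w eta !=set0.
  apply/set0P; apply: contraTneq eta0 => ->; by rewrite prob_set0 // ltxx.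
rewrite lee_fin; apply: le_trans etar _; apply: le_trans (run_Disc_le wfI bV wI rr) _.
by case: rr => rn [ri _]; rewrite ler_rat; apply: (qmax (Ordinal (rn 0%N))).
Qed.

(** Here [- V q] is the least discounted sum from [q]. If [nu] lies below these values, the event at
    [nu] contains every run; for a threshold above [- V q0], the event misses a cylinder around the
    greedy run, so its probability is below 1. *)
Lemma AsDisc_bellman I V :
  wf I -> (0 < nal I)%N -> bellman I (fun q a q' => - gamma I q a q') V ->
  AsDisc_universal I <-> forall q, (q < nst I)%N -> 0 < init I q -> nu I <= - V q.
Proof.
move=> wfI nal0 bV; have hl := ratr_lam wfI.
have DN w r : is_word I w -> is_run I w r ->
    Disc (ratr (lam I)) (weight_seq I w r) =
    - Disc (ratr (lam I)) (gain_seq (fun q a q' => - gamma I q a q') w r).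
  move=> wI rr; rewrite !Disc_dsum -dsumN //; last exact: (run_bounded_gain _ _ wI rr).
  by congr dsum; apply/funext => i; rewrite /gain_seq rmorphN opprK.
split; last first.
  move=> H; split=> // w wI; apply: ereal_sup_ubound; exists (ratr (nu I)) => //=.
  apply/eqP; rewrite eq_le prob_le1 //=.
  apply: (@prob_ge I w wfI wI [::]) => r [_ rr]; split=> //.
  rewrite DN // lerNr; apply: le_trans (run_Disc_le wfI bV wI rr) _.
  by case: rr => rn [ri _]; rewrite -rmorphN ler_rat lerNr; apply: H.
move=> [_ H] q0 q0n q0i.
have [w [r [wI rr r0 gr]]] := exists_greedy bV q0n q0i.
rewrite -(ler_rat RR) -lee_fin; apply: le_trans (H w wI) _.
apply: ge_ereal_sup => _ [eta /= eta1 <-]; rewrite lee_fin leNgt; apply/negP => lt_eta.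
(* Half the gap: sums within [e] of [- V q0] stay strictly below [eta]. *)
pose e : RR := (eta - ratr (- V q0)) / 2.
have e0 : 0 < e by rewrite /e; lra.
have [n nP] := greedy_neighbourhood wfI wI gr e0.
have : (prob I w (event I w eta) <= (1 - prefix_prob I w (mkseq r n))%:E)%E.
  apply: prob_le_compl => //; first by move=> r' [].
  move=> r' [rr' eta_le] /(nP r' rr'); move: eta_le; rewrite DN // r0 /e rmorphN /=.
  lra.
by rewrite eta1 lee_fin leNgt gtrBl prefix_prob_run_gt0.
Qed.

(** * The decision procedures *)

(** Any witness accepted by [R] lets [T] answer correctly, so the least one, which minimisation
    computes, will do. *)
Lemma decidable_search (P : nat -> Prop) (R T : nat -> nat -> bool) :
  compb (fun t : ctx 2 => R t.1 t.2.1) -> compb (fun t : ctx 2 => T t.1 t.2.1) ->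
  (forall n, exists m, R n m) -> (forall n m, R n m -> (P n <-> T n m)) -> decidable_nat P.
Proof.
move=> cR cT exR RP; pose f (t : ctx 1) := ex_minn (exR t.1).
have cf : comp f.
  apply: (comp_mu (R := fun (t : ctx 1) m => R t.1 m)).
  - apply: (comp_subst (s := fun t : ctx 2 => (t.2.1, (t.1, tt)) : ctx 2) cR).
    apply: comps_cons; first exact: comp_wk (comp_var0 _).
    by apply: comps_cons (comps_nil _); exact: comp_var0.
  - by move=> t; rewrite /f; case: ex_minnP.
  - move=> t m; rewrite /f; case: ex_minnP => k _ kmin mk.
    by apply/negP => /kmin; rewrite leqNgt mk.
have [c cP] := comp_app2 (h := fun n m => T n m) cT (comp_var0 0) cf.
exists c => n; have := cP (n, tt); rewrite /f /=; case: ex_minnP => m Rnm _ ev.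
have PT := RP n m Rnm; split=> [/PT|nP]; first by move=> TT; rewrite TT in ev.
by have := ev; case: (T n m) PT => // -[_ /(_ isT)].
Qed.

(** Quantifiers and sums range over [iota] and [index_iota], the shapes handled by [compb_all] and
    [compq_sum]. *)
Definition wfb (I : pwa_instance) : bool :=
  [&& all (fun q => 0 <= init I q) (iota 0 (nst I)),
      \sum_(0 <= q < nst I) init I q == 1,
      all (fun q => all (fun a => all (fun q' => 0 <= delta I q a q') (iota 0 (nst I)))
        (iota 0 (nal I))) (iota 0 (nst I)),
      all (fun q => all (fun a => \sum_(0 <= q' < nst I) delta I q a q' == 1)
        (iota 0 (nal I))) (iota 0 (nst I)),
      0 < lam I & lam I < 1].

Lemma all_iotaP (N : nat) (F : nat -> bool) :
  reflect (forall i, (i < N)%N -> F i) (all F (iota 0 N)).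
Proof.
apply: (iffP allP) => H i; first by move=> iN; apply: H; rewrite mem_iota.
by rewrite mem_iota => /andP[_]; apply: H.
Qed.

Lemma has_iotaP (N : nat) (F : nat -> bool) :
  reflect (exists i, (i < N)%N /\ F i) (has F (iota 0 N)).
Proof.
apply: (iffP hasP) => [[i]|[i [iN Fi]]]; last by exists i; rewrite ?mem_iota.
by rewrite mem_iota => /andP[_ iN] Fi; exists i.
Qed.

Lemma wfP I : reflect (wf I) (wfb I).
Proof.
apply: (iffP idP) => [/and5P[/all_iotaP i0 /eqP i1 /all_iotaP d0 /all_iotaP d1 hl]|].
  split=> //.
  - by rewrite -(big_mkord xpredT (init I)).
  - by move=> q a q' qn an q'n; have /all_iotaP /(_ a an)/all_iotaP := d0 q qn; apply.
  - move=> q a qn an; rewrite -(big_mkord xpredT (delta I q a)).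
    by have /all_iotaP /(_ a an)/eqP := d1 q qn.
case=> i0 i1 d0 d1 /andP[l0 l1]; apply/and5P; split.
- exact/all_iotaP.
- by rewrite big_mkord i1.
- by apply/all_iotaP => q qn; apply/all_iotaP => a an; apply/all_iotaP => q'; apply: d0.
- by apply/all_iotaP => q qn; apply/all_iotaP => a an; rewrite big_mkord d1.
- by rewrite l0.
Qed.

Definition bellmanb (I : pwa_instance) (g : nat -> nat -> nat -> rat) (V : nat -> rat) : bool :=
  all (fun q =>
    has (fun a => has (fun q' => (0 < delta I q a q') && (V q == g q a q' + lam I * V q'))
      (iota 0 (nst I))) (iota 0 (nal I)) &&
    all (fun a => all (fun q' => (delta I q a q' <= 0) || (g q a q' + lam I * V q' <= V q))
      (iota 0 (nst I))) (iota 0 (nal I)))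
  (iota 0 (nst I)).

Lemma bellmanP I g V : reflect (bellman I g V) (bellmanb I g V).
Proof.
apply: (iffP (all_iotaP _ _)) => H q qn; have := H q qn.
  move=> /andP[/has_iotaP[a [an /has_iotaP[q' [q'n /andP[d /eqP E]]]]] le]; split.
    by exists a, q'; rewrite /edge an q'n d.
  move=> b p /and3P[bn pn d']; move/all_iotaP: le => /(_ b bn)/all_iotaP/(_ p pn).
  by rewrite leNgt d'.
move=> [[a [q' [/and3P[an q'n d] E]]] le]; apply/andP; split.
  by apply/has_iotaP; exists a; split=> //; apply/has_iotaP; exists q'; rewrite d E eqxx.
apply/all_iotaP => b bn; apply/all_iotaP => p pn; case: leP => //= d'.
by apply: le; rewrite /edge bn pn d'.
Qed.

Definition values (m q : nat) : rat := decode_rat (nth 0%N (decode_list m) q).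

Lemma values_surj n (V : nat -> rat) : exists m, forall q, (q < n)%N -> values m q = V q.
Proof.
have /choice[e eP] := fun q => decode_rat_surj (V q).
have [m mP] := decode_list_surj (mkseq e n).
by exists m => q qn; rewrite /values mP nth_mkseq.
Qed.

Definition neg_gain (I : pwa_instance) q a q' : rat := - gamma I q a q'.

(* The first disjunct makes the search for a solution terminate on every input. *)
Definition is_solution (I : pwa_instance) (g : nat -> nat -> nat -> rat) (m : nat) : bool :=
  ~~ (wfb I && (0 < nal I)%N) || bellmanb I g (values m).

Lemma exists_solution I g : exists m, is_solution I g m.
Proof.
rewrite /is_solution; have [/andP[/wfP wfI nal0]|_] := boolP (_ && _); last by exists 0%N.
have [V bV] := exists_bellman g wfI nal0.
have [m mP] := values_surj (nst I) V.
by exists m; apply/bellmanP; apply: eq_bellman bV => q qn; rewrite mP.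
Qed.

(** Over an empty alphabet there is no word, hence a negative answer whatever [m] is. *)
Definition pos_test (I : pwa_instance) (m : nat) : bool :=
  [&& wfb I, (0 < nal I)%N &
      has (fun q => (0 < init I q) && (nu I <= values m q)) (iota 0 (nst I))].

Lemma pos_testP I m : is_solution I (gamma I) m -> (PosDisc_nonempty I <-> pos_test I m).
Proof.
rewrite /is_solution /pos_test; case: wfP => [wfI|nwf] /=; last by move=> _; split=> // -[].
case: posnP => [nal0 _|nal0 /bellmanP bV].
  by split=> // -[_ [w [/(_ 0%N)]]]; rewrite nal0.
rewrite (PosDisc_bellman wfI nal0 bV); split.
  by move=> [q [qn qi qV]]; apply/has_iotaP; exists q; rewrite qi qV.
by move=> /has_iotaP[q [qn /andP[qi qV]]]; exists q.
Qed.

(** Over an empty alphabet universality is vacuous, but well-formedness is still demanded. *)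
Definition as_test (I : pwa_instance) (m : nat) : bool :=
  wfb I && ((nal I <= 0)%N ||
    all (fun q => (init I q <= 0) || (nu I <= - values m q)) (iota 0 (nst I))).

Lemma as_testP I m : is_solution I (neg_gain I) m -> (AsDisc_universal I <-> as_test I m).
Proof.
rewrite /is_solution /as_test; case: wfP => [wfI|nwf] /=; last by move=> _; split=> // -[].
case: posnP => [nal0 _|nal0 /bellmanP bV].
  by rewrite nal0; split=> // _; split=> // w /(_ 0%N); rewrite nal0.
rewrite leqNgt nal0 (AsDisc_bellman wfI nal0 bV); split=> [H|/all_iotaP H q qn qi].
  by apply/all_iotaP => q qn; case: leP => //= qi; apply: H.
by have := H q qn; rewrite leNgt qi.
Qed.

(** * Computability of the data of a coded instance *)

Section Decode.
Variables (k : nat) (n : ctx k -> nat).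
Hypothesis cn : comp n.

Lemma comp_nst : comp (fun t => nst (decode (n t))).
Proof. exact: comp_decode_list cn (comp_const _ _). Qed.

Lemma comp_nal : comp (fun t => nal (decode (n t))).
Proof. exact: comp_decode_list cn (comp_const _ _). Qed.

Lemma compq_lam : compq (fun t => lam (decode (n t))).
Proof. exact: compq_decode_rat (comp_decode_list cn (comp_const _ _)). Qed.

Lemma compq_nu : compq (fun t => nu (decode (n t))).
Proof. exact: compq_decode_rat (comp_decode_list cn (comp_const _ _)). Qed.

Lemma compq_init q : comp q -> compq (fun t => init (decode (n t)) (q t)).
Proof.
move=> cq; apply/compq_decode_rat/comp_decode_list => //.
by apply: comp_add; first exact: comp_const.
Qed.

Lemma compq_delta q a q' : comp q -> comp a -> comp q' ->
  compq (fun t => delta (decode (n t)) (q t) (a t) (q' t)).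
Proof.
move=> cq ca cq'; apply/compq_decode_rat/comp_decode_list => //.
have := (comp_nst, comp_nal) => -[cs cl]; have c4 := comp_const k 4.
by do ?[apply: comp_add|apply: comp_mul].
Qed.

Lemma compq_gamma q a q' : comp q -> comp a -> comp q' ->
  compq (fun t => gamma (decode (n t)) (q t) (a t) (q' t)).
Proof.
move=> cq ca cq'; apply/compq_decode_rat/comp_decode_list => //.
have := (comp_nst, comp_nal) => -[cs cl]; have c4 := comp_const k 4.
by do ?[apply: comp_add|apply: comp_mul].
Qed.

Lemma compq_values q : comp q -> compq (fun t => values (n t) (q t)).
Proof. by move=> cq; apply/compq_decode_rat/comp_decode_list. Qed.
End Decode.

Lemma comp_var1 k : comp (fun t : ctx k.+2 => t.2.1).
Proof. exact: comp_wk (comp_var0 _). Qed.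

Lemma comp_var2 k : comp (fun t : ctx k.+3 => t.2.2.1).
Proof. exact: comp_wk (comp_var1 _). Qed.

Lemma comp_var3 k : comp (fun t : ctx k.+4 => t.2.2.2.1).
Proof. exact: comp_wk (comp_var2 _). Qed.

Lemma comp_var4 k : comp (fun t : ctx k.+4.+1 => t.2.2.2.2.1).
Proof. exact: comp_wk (comp_var3 _). Qed.

(** Recursion on the shape of the body. Each quantifier or sum pushes its variable onto the context,
    so projections of [t] act as de Bruijn indices. *)
Ltac computable := cbv beta; lazymatch goal with
  | |- compb (fun t => _ && _) => apply: compb_and; computable
  | |- compb (fun t => _ || _) => apply: compb_or; computable
  | |- compb (fun t => ~~ _) => apply: compb_not; computable
  | |- compb (fun t => all _ (iota 0 _)) => apply: compb_all; computable
  | |- compb (fun t => has _ (iota 0 _)) => apply: compb_has; computable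
  | |- compb (fun t => leq _ _) => apply: compb_leq; computable
  | |- compb (fun t => Order.le _ _) => apply: compb_ler; computable
  | |- compb (fun t => Order.lt _ _) => apply: compb_ltr; computable
  | |- compb (fun t => _ == _) => apply: compb_eqr; computable
  | |- compq (fun t => - _) => apply: compq_opp; computable
  | |- compq (fun t => _ + _) => apply: compq_add; computable
  | |- compq (fun t => _ * _) => apply: compq_mul; computable
  | |- compq (fun t => bigop _ _ _) => apply: compq_sum; computable
  | |- compq (fun t => 0) => exact: (compq_const _ 0)
  | |- compq (fun t => 1) => exact: (compq_const _ 1)
  | |- compq (fun t => lam _) => apply: compq_lam; computable
  | |- compq (fun t => nu _) => apply: compq_nu; computable
  | |- compq (fun t => init _ _) => apply: compq_init; computable
  | |- compq (fun t => delta _ _ _ _) => apply: compq_delta; computable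
  | |- compq (fun t => gamma _ _ _ _) => apply: compq_gamma; computable
  | |- compq (fun t => values _ _) => apply: compq_values; computable
  | |- comp (fun t => nst _) => apply: comp_nst; computable
  | |- comp (fun t => nal _) => apply: comp_nal; computable
  | |- comp (fun t => S _) => apply: comp_succ; computable
  | |- comp (fun t => O) => exact: comp_const
  | |- comp fst => exact: comp_var0
  | |- comp (fun t => t.2.1) => exact: comp_var1
  | |- comp (fun t => t.2.2.1) => exact: comp_var2
  | |- comp (fun t => t.2.2.2.1) => exact: comp_var3
  | |- comp (fun t => t.2.2.2.2.1) => exact: comp_var4
  | |- _ => idtac
  end.

(** Under the three quantifiers of [bellmanb] the context lists [q'], [a], [q], the code of the
    instance and the candidate [m]. *)
Lemma compb_is_solution (g : pwa_instance -> nat -> nat -> nat -> rat) :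
  compq (fun t : ctx 5 => g (decode t.2.2.2.1) t.2.2.1 t.2.1 t.1) ->
  compb (fun t : ctx 2 => is_solution (decode t.1) (g (decode t.1)) t.2.1).
Proof.
move=> cg.
by rewrite /is_solution /wfb /bellmanb; computable.
Qed.

Theorem theorem11 :
  decidable_nat (fun n => PosDisc_nonempty (decode n)) /\
  decidable_nat (fun n => AsDisc_universal (decode n)).
Proof.
split.
- apply: (decidable_search (R := fun n m => is_solution (decode n) (gamma (decode n)) m)
    (T := fun n m => pos_test (decode n) m)).
  + by apply: compb_is_solution; computable.
  + by rewrite /pos_test /wfb; computable.
  + by move=> n; apply: exists_solution.
  + by move=> n m; apply: pos_testP.
- apply: (decidable_search (R := fun n m => is_solution (decode n) (neg_gain (decode n)) m)
    (T := fun n m => as_test (decode n) m)).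
  + by apply: compb_is_solution; rewrite /neg_gain; computable.
  + by rewrite /as_test /wfb; computable.
  + by move=> n; apply: exists_solution.
  + by move=> n m; apply: as_testP.
Qed.
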